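(* Let $\mathfrak{B}$ be the class of finite groups $G$ such that $\Phi(G/N)=1$ for all normal subgroups $N$ of $G$, and let $\mathfrak{F}$ be the class of all finite groups $G$ such that $\Phi(G/N)=\Phi(G)N/N$ for all normal subgroups $N$ of $G$. The following assertions are valid: (1) The class $\mathfrak{B}$ is a subnormally closed totally non-saturated formation (tn-formation). (2) $\mathfrak{F}=E_{\Phi}\mathfrak{B}=\mathfrak{N}\mathfrak{B}$, where $\mathfrak{N}$ is the class of all finite nilpotent groups. (3) The class $\mathfrak{F}$ is the smallest saturated formation containing $\mathfrak{B}$, and it is locally defined by the formation function $f$ given by $f(p)=\mathfrak{B}$ for all primes $p$. Moreover, $\mathfrak{F}$ is closed under taking subnormal subgroups.
   Context: All groups are finite, and classes of groups are closed under isomorphism. $\Phi(G)$ denotes the Frattini subgroup of $G$. A formation is a class of groups $\mathfrak{X}$ closed under epimorphic images and subdirect products (if $M,N$ are normal in $G$ and $G/M,G/N\in\mathfrak{X}$, then $G/(M\cap N)\in\mathfrak{X}$). A saturated formation is a formation which is also closed under Frattini extensions (if $N$ is normal in $G$, $N\leq\Phi(G)$ and $G/N\in\mathfrak{X}$, then $G\in\mathfrak{X}$). A class is subnormally closed if it contains every subnormal subgroup of each of its members. For a formation $\mathfrak{X}$, the $\mathfrak{X}$-residual $G^{\mathfrak{X}}$ of a group $G$ is the smallest normal subgroup of $G$ with quotient in $\mathfrak{X}$. A chief factor of $G$ is a quotient $K/L$ with $K,L$ normal in $G$ and $K/L$ a minimal normal subgroup of $G/L$; it is Frattini if $K/L\leq\Phi(G/L)$.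 A totally non-saturated formation (tn-formation) is a formation $\mathfrak{X}$ such that, in each group $G$, every chief factor of the form $G^{\mathfrak{X}}/K$ is Frattini. $E_{\Phi}\mathfrak{B}$ is the class of groups $G$ having a normal subgroup $N\leq\Phi(G)$ with $G/N\in\mathfrak{B}$. $\mathfrak{N}\mathfrak{B}$ is the class of groups $G$ having a nilpotent normal subgroup $N$ with $G/N\in\mathfrak{B}$. A formation function $f$ assigns to each prime $p$ a (possibly empty) formation $f(p)$; a class $\mathfrak{X}$ is locally defined by $f$ if $\mathfrak{X}$ consists exactly of the groups $G$ such that $G/C_G(H/K)\in f(p)$ for every chief factor $H/K$ of $G$ and every prime $p$ dividing $|H/K|$, where $C_G(H/K)$ is the kernel of the conjugation action of $G$ on $H/K$. *)

(* Defs.v *)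
From mathcomp Require Import all_boot all_fingroup all_solvable.

Set Implicit Arguments.
Unset Strict Implicit.
Unset Printing Implicit Defensive.

Import GroupScope.

(* The finite groups are the groups G : {group gT}, for gT ranging over all
   finGroupTypes.  Invariance under isomorphism is not built into group_class;
   it is the first clause of formation. *)
Definition group_class := forall gT : finGroupType, {group gT} -> Prop.

Definition isom_closed (X : group_class) : Prop :=
  forall (gT rT : finGroupType) (G : {group gT}) (H : {group rT}),
    G \isog H -> X gT G -> X rT H.

Definition subclass (X Y : group_class) : Prop :=
  forall (gT : finGroupType) (G : {group gT}), X gT G -> Y gT G.

Definition eqclass (X Y : group_class) : Prop :=
  forall (gT : finGroupType) (G : {group gT}), X gT G <-> Y gT G.

Definition epi_closed (X : group_class) : Prop :=
  forall (gT rT : finGroupType) (G : {group gT}) (f : {morphism G >-> rT}),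
    X gT G -> X rT (f @* G)%G.

Definition subdirect_closed (X : group_class) : Prop :=
  forall (gT : finGroupType) (G M N : {group gT}), M <| G -> N <| G ->
    X (coset_of M) (G / M)%G -> X (coset_of N) (G / N)%G ->
    X (coset_of (M :&: N)) (G / (M :&: N))%G.

Definition formation (X : group_class) : Prop :=
  [/\ isom_closed X, epi_closed X & subdirect_closed X].

Definition frattini_closed (X : group_class) : Prop :=
  forall (gT : finGroupType) (G N : {group gT}),
    N <| G -> N \subset 'Phi(G) -> X (coset_of N) (G / N)%G -> X gT G.

Definition saturated_formation (X : group_class) : Prop :=
  formation X /\ frattini_closed X.

Definition subnormally_closed (X : group_class) : Prop :=
  forall (gT : finGroupType) (G H : {group gT}), H <|<| G -> X gT G -> X gT H.

Definition is_residual (X : group_class) (gT : finGroupType)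
    (G R : {group gT}) : Prop :=
  [/\ R <| G, X (coset_of R) (G / R)%G
    & forall N : {group gT},
        N <| G -> X (coset_of N) (G / N)%G -> R \subset N].

(* A residual exists (uniquely) in every group as soon as the formation X is
   nonempty. *)
Definition tn_formation (X : group_class) : Prop :=
  formation X /\
  forall (gT : finGroupType) (G R K : {group gT}),
    is_residual X G R -> chief_factor G K R -> R / K \subset 'Phi(G / K).

Definition EPhi (X : group_class) : group_class := fun gT G =>
  exists N : {group gT},
    [/\ N <| G, N \subset 'Phi(G) & X (coset_of N) (G / N)%G].

Definition nilpotent_by (X : group_class) : group_class := fun gT G =>
  exists N : {group gT},
    [/\ N <| G, nilpotent N & X (coset_of N) (G / N)%G].

(* Only the values of f at primes are relevant. *)
Definition formation_function (f : nat -> group_class) : Prop :=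
  forall p : nat, prime p -> formation (f p).

(* chief_factor G K H is the chief factor H / K, and 'C_G(H / K | 'Q) is the
   kernel of the conjugation action of G on it. *)
Definition locally_defined (X : group_class) (f : nat -> group_class) : Prop :=
  forall (gT : finGroupType) (G : {group gT}),
    X gT G <->
    forall (H K : {group gT}) (p : nat),
      chief_factor G K H -> prime p -> p %| #|H / K| ->
      f p (coset_of 'C_G(H / K | 'Q)) (G / 'C_G(H / K | 'Q))%G.

Definition classB : group_class := fun gT G =>
  forall N : {group gT}, N <| G -> 'Phi(G / N) = 1.

Definition classF : group_class := fun gT G =>
  forall N : {group gT}, N <| G -> 'Phi(G / N) = ('Phi(G) * N) / N.

(* Main.v *)
Require Import Defs.
From mathcomp Require Import all_boot all_fingroup all_solvable.

(* A group lies in B exactly when it has no Frattini chief factor.  The key point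
   (Phi_free_over_chief) is that one chief series suffices: if A / R is a
   non-Frattini chief factor of G and no chief factor above A is Frattini, then no
   chief factor of G / R is Frattini.  So membership in B can be checked one chief
   factor at a time, which gives closure under subdirect products and the tn
   property at once.
   If Phi(G) = 1 and N is nilpotent and normal with G / N in B, then the chief
   factors below N are complemented, so G is in B; this identifies E_Phi B with NB,
   and most assertions on F are then proved for NB.
   For H normal in G in B, let A be minimal normal in G below H.  By induction H / A
   is in B, and Phi(H) <= Phi(G) = 1.  If A is nilpotent, H is in NB; otherwise
   A contains no nontrivial nilpotent normal subgroup of H, while every normal
   subgroup of H in A has an H-invariant complement in A, so the nilpotent group
   Phi(H / N) is trivial.
   For the local definition, nilpotent normal subgroups centralize every chief
   factor, and conversely the intersection of the centralizers in a chief series is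
   nilpotent. *)

Set Implicit Arguments.
Unset Strict Implicit.
Unset Printing Implicit Defensive.

Import GroupScope.

(** * Frattini subgroups of quotients, seen through maximal subgroups of [G] *)

Section FrattiniQuotients.

Variable gT : finGroupType.
Implicit Types A B G H K L M N R U X : {group gT}.

Lemma maximal_mulg G H A : maximal H G -> A <| G -> ~~ (A \subset H) -> A * H = G.
Proof.
move=> maxH /andP[sAG nAG] nsAH; have sHG := maxgroupp maxH.
have nAH: H \subset 'N(A) := subset_trans (proper_sub sHG) nAG.
case/maximal_eqP: (predU1r H G maxH) => _ /(_ (A <*> H)%G).
rewrite joing_subr join_subG sAG proper_sub //= norm_joinEr // => -[] // AH.
by case/negP: nsAH; rewrite -AH mulG_subl.
Qed.

Lemma quotient_sub_Phi G N X : N <| G -> N \subset X -> X \subset G ->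
  reflect (forall M, maximal M G -> N \subset M -> X \subset M)
          (X / N \subset 'Phi(G / N)).
Proof.
move=> nsNG sNX sXG; have nNG := normal_norm nsNG.
have nNX := subset_trans sXG nNG.
apply: (iffP bigcapsP) => [sX M maxM sNM | sX Mb].
  have [sMG _] := andP (maxgroupp maxM); have nsNM := normalS sNM sMG nsNG.
  rewrite -(quotientSGK nNX sNM); apply: (sX (M / N)%G).
  by rewrite quotient_maximal_eq //; apply: predU1r.
case/predU1P=> [-> | maxMb]; first exact: quotientS.
rewrite sub_quotient_pre //; apply: sX.
  by rewrite -(quotientGK nsNG) cosetpre_maximal.
by rewrite sub_cosetpre.
Qed.

(** The preimage of ['Phi(G / M)] is itself normal in [G], so testing normal subgroups [X] above [M]
    suffices. *)
Lemma Phi_quotient_trivP G M : M <| G ->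
  reflect (forall X, X <| G -> M \subset X ->
             (forall L, maximal L G -> M \subset L -> X \subset L) -> X \subset M)
          ('Phi(G / M) == 1).
Proof.
move=> nsMG; have nMG := normal_norm nsMG.
apply: (iffP eqP) => [Phi1 X /andP[sXG _] sMX sX | Phi1].
  rewrite -quotient_sub1 ?(subset_trans sXG) // -Phi1.
  exact/quotient_sub_Phi.
have nsXG: coset M @*^-1 'Phi(G / M) <| G.
  by rewrite -{2}(quotientGK nsMG) cosetpre_normal Phi_normal.
apply/trivgP; rewrite -cosetpreSK cosetpre1 /=; apply: Phi1 => //.
  exact: sub_cosetpre.
apply/quotient_sub_Phi; rewrite ?sub_cosetpre ?normal_sub //.
by rewrite cosetpreK.
Qed.

Lemma Phi_quotient1_sub G M X : M <| G -> 'Phi(G / M) = 1 -> X <| G ->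
  (forall L, maximal L G -> M \subset L -> X \subset L) -> X \subset M.
Proof.
move=> nsMG /eqP/(Phi_quotient_trivP nsMG) PhiM nsXG sX.
have /PhiM : X <*> M <| G by rewrite normalY.
rewrite joing_subr join_subG => /(_ isT) IH.
have /andP[] // : (X \subset M) && (M \subset M).
by apply: IH => L maxL sML; rewrite join_subG sML sX.
Qed.

Lemma not_Phi_quotient G N X : N <| G -> N \subset X -> X \subset G ->
  ~~ (X / N \subset 'Phi(G / N)) ->
  exists M, [/\ maximal M G, N \subset M & ~~ (X \subset M)].
Proof.
move=> nsNG sNX sXG nPhi.
suff /exists_inP[M maxM /andP[]]: [exists (M : {group gT} | maximal M G),
    (N \subset M) && ~~ (X \subset M)] by exists M.
apply: contraR nPhi; rewrite negb_exists_in => /forall_inP nM.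
apply/quotient_sub_Phi=> // M /nM; rewrite negb_and negbK.
by case/orP=> // /negP.
Qed.

(* [A * (H :&: K)] is a proper subgroup of [G] supplementing [B]. *)
Lemma maximal_over_avoiding G A B H K :
    maximal H G -> maximal K G -> A <| G -> B <| G ->
    ~~ (A \subset H) -> ~~ (B \subset K) -> B \subset H -> A :&: H \subset K ->
  exists M, [/\ maximal M G, A \subset M & ~~ (B \subset M)].
Proof.
move=> maxH maxK nsAG nsBG nAH nBK sBH sAHK.
have [sHG neqHG] := andP (maxgroupp maxH).
have [sAG nAG] := andP nsAG; have [sBG nBG] := andP nsBG.
have sIG: H :&: K \subset G := subset_trans (subsetIl _ _) sHG.
have defBI: B * (H :&: K) = H.
  by rewrite setIC group_modl // (maximal_mulg maxK) // (setIidPr sHG).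
have defJ: A <*> (H :&: K) = A * (H :&: K).
  by rewrite norm_joinEr // (subset_trans sIG).
have /maximal_exists[]: A <*> (H :&: K) \subset G by rewrite join_subG sAG.
  (* If [A (H :&: K)] were [G], Dedekind's law would give [H = (H :&: A)(H :&: K)], which lies in
     [K]; but [H] contains [B]. *)
  rewrite /= defJ => eqG.
  have sHK: H \subset K.
    have <-: (H :&: A) * (H :&: K) = H.
      by rewrite group_modr ?subsetIl // eqG (setIidPl sHG).
    by rewrite mul_subG ?subsetIr // setIC.
  case/negP: nBK; apply: subset_trans sBH _ => //.
case=> M maxM; rewrite join_subG => /andP[sAM sIM]; exists M; split=> //.
apply: contra neqHG => sBM; case/andP: (maxgroupp maxM) => _ /negP[].
rewrite -(maximal_mulg maxH nsAG nAH) mul_subG //.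
by rewrite -defBI mul_subG.
Qed.

(* [G / N] is in B, stated inside [G]. *)
Definition Phi_free_over G (N : {set gT}) :=
  forall M, M <| G -> N \subset M -> 'Phi(G / M) = 1.

Lemma chief_normalI G R A N : chief_factor G R A -> N <| G -> R \subset N ->
  A \subset N \/ A :&: N = R.
Proof.
case/andP=> /maxgroupP[/andP[ltRA nRG] maxR] nsAG nsNG sRN.
have sRAN: R \subset A :&: N by rewrite subsetI proper_sub.
case: (boolP (A \subset N)) => [|nAN]; [by left | right].
apply: (maxR (A :&: N)%G) => //; rewrite normsI ?normal_norm // andbT.
by rewrite properEneq subsetIl andbT; apply: contra nAN => /eqP/setIidPl.
Qed.

End FrattiniQuotients.

Lemma nilpotent_Sylow_normal gT (G : {group gT}) :
  (forall (p : nat) (P : {group gT}), p.-Sylow(G) P -> P <| G) -> nilpotent G.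
Proof.
move=> nSyl; apply: nilpotentS (Fitting_nil G); rewrite -{1}(Sylow_gen G) gen_subG.
apply/bigcupsP=> P /SylowP[p _ sylP]; rewrite Fitting_max ?(nSyl p) //.
exact: pgroup_nil (pHall_pgroup sylP).
Qed.

Lemma Phi_nil gT (G : {group gT}) : nilpotent 'Phi(G).
Proof.
apply: nilpotent_Sylow_normal => p P sylP.
have sPPhi := pHall_sub sylP; have nsPhi := Phi_normal G.
have defG := Frattini_arg nsPhi sylP.
have sNG : 'N_G(P) \subset G := subsetIl _ _.
have {}defG : 'Phi(G) <*> 'N_G(P) = G.
  by rewrite norm_joinEr ?defG // (subset_trans sNG) ?normal_norm.
rewrite /normal sPPhi; move/Phi_nongen: defG; rewrite genGid => defG.
by rewrite (subset_trans (normal_sub nsPhi)) // -defG subsetIr.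
Qed.

(** * Passing down one non-Frattini chief factor *)

Section ChiefStep.

Variable gT : finGroupType.
Implicit Types A B G H K L M N R U X : {group gT}.

Lemma Phi_free_overS G N M : N \subset M -> Phi_free_over G N -> Phi_free_over G M.
Proof. by move=> sNM freeN K nsKG sMK; rewrite freeN ?(subset_trans sNM). Qed.

(** If [A] lies in [M], [freeA] applies directly. Otherwise [A :&: M = R], and [freeA] confines a
    Frattini [X / M] to [AM / M]. By Dedekind's law only the case of [A] inside [X] remains; it is
    refuted by building a maximal subgroup above [M] that misses [A]. *)
Lemma Phi_free_over_chief G R A H :
    chief_factor G R A -> maximal H G -> R \subset H -> ~~ (A \subset H) ->
  Phi_free_over G A -> Phi_free_over G R.
Proof.
move=> chA maxH sRH nAH freeA.
have [/maxgroupP[/andP[/andP[sRA _] nRG] _] nsAG] := andP chA.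
have [sAG nAG] := andP nsAG; have [sHG _] := andP (maxgroupp maxH).
have nsRG : R <| G by rewrite /normal (subset_trans sRA).
move=> M nsMG sRM; apply/eqP/(Phi_quotient_trivP nsMG) => X nsXG sMX sX.
case: (chief_normalI chA nsMG sRM) => [sAM | tiAM].
  exact: Phi_quotient1_sub nsMG (freeA M nsMG sAM) nsXG sX.
have [sMG nMG] := andP nsMG.
pose AM := (A <*> M)%G; have nsAMG : AM <| G by rewrite normalY.
have defAM : AM = A * M :> {set gT} by rewrite /= norm_joinEr ?(subset_trans sMG).
have sAAM : A \subset AM := joing_subl _ _.
have sMAM : M \subset AM := joing_subr _ _.
have sXAM : X \subset AM.
  apply: (Phi_quotient1_sub nsAMG (freeA AM nsAMG sAAM) nsXG) => L maxL sAML.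
  by rewrite sX // (subset_trans sMAM).
case: (chief_normalI chA nsXG (subset_trans sRM sMX)) => [sAX | tiAX]; last first.
  have <- : (X :&: A) * M = X.
    by rewrite group_modr // -defAM (setIidPl sXAM).
  by rewrite setIC tiAX mul_subG.
have bad L : maximal L G -> M \subset L -> A \subset L.
  by move=> maxL sML; rewrite (subset_trans sAX) ?sX.
have nMH : ~~ (M \subset H) by apply: contra nAH; apply: bad.
exfalso.
have abAR : A^`(1) \subset R.
  rewrite der1_min ?(subset_trans sAG) //.
  (* [A / R] is isomorphic to the image of [A] in [G / M], which lies in the nilpotent group
     ['Phi(G / M)]. *)
  have nilAR : nilpotent (A / R).
    rewrite -tiAM setIC (isog_nil (second_isog (subset_trans sAG nMG))).
    apply: nilpotentS (Phi_nil (G / M)); apply: subset_trans (quotientS M sAX) _.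
    exact/(quotient_sub_Phi nsMG sMX (normal_sub nsXG)).
  have minA := chief_factor_minnormal chA.
  have [] := minnormal_solvable minA (subxx _) (nilpotent_sol nilAR).
  by move=> _ _ /is_abelemP[p _ /abelem_abelian].
(* Like [M], [Ms] is a normal subgroup of [G] complementing [A] in [AM] over [R];
   the contradiction comes from the chief factor [AM / Y], with [Y = A (M :&: Ms)]. *)
pose Ms := (H :&: AM)%G.
have sRMs : R \subset Ms by rewrite subsetI sRH (subset_trans sRA).
have cAAM : [~: A, AM] \subset R.
  have nRA := subset_trans sAG nRG; have nRM := subset_trans sMG nRG.
  rewrite -quotient_cents2 ?join_subG ?nRA //= quotientY // centY subsetI.
  rewrite !quotient_cents2 // abAR -tiAM commg_subI // subsetI subxx.
    exact: subset_trans sAG nMG.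
  exact: subset_trans sMG nAG.
(* [H] normalizes [Ms], and so does [A] because [[~: A, Ms]] lies in [R]; and [A H = G]. *)
have nsMs : Ms <| G.
  rewrite /normal subIset ?sHG // -(maximal_mulg maxH nsAG nAH) mul_subG //.
    rewrite -commg_subr; apply: subset_trans sRMs; apply: subset_trans cAAM.
    by rewrite commgS ?subsetIr.
  by rewrite normsI ?normG // (subset_trans sHG) ?normal_norm.
have defMs : A * Ms = AM.
  by rewrite group_modl // (maximal_mulg maxH) // (setIidPr (normal_sub nsAMG)).
(* [AM / Ms] is an image of [A], whose derived subgroup lies in [R], so it is abelian. *)
have dM : M^`(1) \subset Ms.
  apply: subset_trans (dergS 1 sMAM) _.
  rewrite der1_min ?(subset_trans (normal_sub nsAMG)) ?normal_norm //.
  have nMsA : A \subset 'N(Ms) := subset_trans sAG (normal_norm nsMs).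
  rewrite -defMs quotientMidr sub_der1_abelian //.
  exact: subset_trans abAR sRMs.
pose Rp := (M :&: Ms)%G; have nsRp : Rp <| G by rewrite normalI.
pose Y := (A <*> Rp)%G; have nsY : Y <| G by rewrite normalY.
have sRRp : R \subset Rp by rewrite subsetI sRM.
have sRpH : Rp \subset H by rewrite /= setIA subIset // subsetIr.
have nMY : ~~ (M \subset Y).
  apply: contra nMH => sMY; rewrite (subset_trans _ sRpH) //.
  have <- : (M :&: A) * Rp = M.
    rewrite group_modr ?subsetIl // -norm_joinEr ?(setIidPl sMY) //.
    by rewrite (subset_trans (normal_sub nsRp)).
  by rewrite setIC tiAM mul_subG.
have [|||L [maxL sYL nML]] := @not_Phi_quotient _ G Y (AM) nsY.
- by rewrite join_subG sAAM /= subIset ?sMAM.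
- exact: normal_sub.
- rewrite (freeA Y) ?joing_subl // quotient_sub1.
    by rewrite join_subG (negPf nMY) andbF.
  by rewrite (subset_trans (normal_sub nsAMG)) ?normal_norm.
have sAL : A \subset L := subset_trans (joing_subl _ _) sYL.
have sRpL : Rp \subset L := subset_trans (joing_subr _ _) sYL.
have {}nML : ~~ (M \subset L) by apply: contra nML => sML; rewrite join_subG sAL.
have [sLG _] := andP (maxgroupp maxL).
(* The derived subgroup of [M] lies in [Rp], hence in [L], so [M] normalizes [M :&: L]; so does [L],
   and [M L = G]. *)
have nsML : (M :&: L)%G <| G.
  rewrite /normal subIset ?sMG // -(maximal_mulg maxL nsMG nML) mul_subG //=.
    rewrite -commg_subr; apply: subset_trans (_ : Rp \subset _).
      rewrite subsetI (subset_trans (commgS _ (subsetIl _ _))) ?der1_subG //.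
      exact: subset_trans (commgS _ (subsetIl _ _)) dM.
    by rewrite subsetI subsetIl sRpL.
  by rewrite normsI ?normG // (subset_trans sLG).
(* Otherwise [(M :&: L) H = G], so [M = (M :&: L)(H :&: M)]; as [H :&: M] lies in [Rp], this would
   put [M] in [L]. *)
have sMLH : M :&: L \subset H.
  apply: contraR nML => /(maximal_mulg maxH nsML) defG.
  have <- : (M :&: L) * (H :&: M) = M.
    by rewrite group_modl ?subsetIl //= defG (setIidPr sMG).
  rewrite mul_subG ?subsetIr // (subset_trans _ sRpL) //.
  by rewrite subsetI subsetIr /= subsetI subsetIl /= subIset // sMAM orbT.
(* Here [M], [A], [L], [H] play the roles of [A], [B], [H], [K] in that lemma. *)
have [K [maxK sMK /negP[]]] := maximal_over_avoiding maxL maxH nsMG nsAG nML nAH sAL sMLH.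
exact: bad.
Qed.

End ChiefStep.

(** * The class B is a tn-formation *)

Section FormationB.

Variable gT : finGroupType.
Implicit Types A B G H K L M N R U X : {group gT}.

(** Induction on [#|M|]. With [M / R] a chief factor and [R] above [M :&: N], the intersection
    [R :&: N] is still [M :&: N]. Dedekind's law keeps [M] out of [R N], so [freeN] provides a
    maximal subgroup above [R N] that misses [M]: the factor [M / R] is not Frattini. *)
Lemma Phi_free_overI G M N : M <| G -> N <| G ->
  Phi_free_over G M -> Phi_free_over G N -> Phi_free_over G (M :&: N).
Proof.
have [m] := ubnP #|M|; elim: m M => // m IHm M leMm nsMG nsNG freeM freeN.
case: (boolP (M \subset N)) => [/setIidPl -> // | nMN].
have nsIG := normalI nsMG nsNG.
have [R maxR sIR] : {R : {group gT} | maxnormal R M G & (M :&: N)%G \subset R}.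
  apply: maxgroup_exists; rewrite (normal_norm nsIG) andbT.
  by rewrite properE subsetIl subsetI subxx.
have /andP[ltRM nRG] := maxgroupp maxR; have sRM := proper_sub ltRM.
have nsRG : R <| G by rewrite /normal (subset_trans sRM (normal_sub nsMG)).
have defI : R :&: N = M :&: N.
  by apply/eqP; rewrite eqEsubset setSI //= subsetI sIR subsetIr.
rewrite -defI; apply: IHm => //.
  exact: leq_trans (proper_card ltRM) _.
pose Y := (R <*> N)%G; have nsYG : Y <| G by rewrite normalY.
have nMY : ~~ (M \subset Y).
  apply: contraL ltRM => sMY; rewrite properE sRM negbK.
  have <- : R * (M :&: N) = M.
    rewrite setIC group_modl // -norm_joinEl ?(setIidPr sMY) //.
    exact: subset_trans (normal_sub nsRG) (normal_norm nsNG).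
  by rewrite mul_subG.
have [|||L [maxL sYL nML]] := @not_Phi_quotient _ G Y (Y <*> M) nsYG.
- exact: joing_subl.
- by rewrite join_subG !normal_sub.
- rewrite (freeN Y) ?joing_subr // quotient_sub1.
    by rewrite join_subG (negPf nMY) andbF.
  by rewrite join_subG normG (subset_trans (normal_sub nsMG)) ?normal_norm.
apply: (@Phi_free_over_chief _ G R M L) => //.
- by rewrite /chief_factor maxR.
- exact: subset_trans (joing_subl _ _) sYL.
- by apply: contra nML => sML; rewrite join_subG sYL.
Qed.

End FormationB.

Lemma isog_Phi_eq1 (gT rT : finGroupType) (G : {group gT}) (H : {group rT}) :
  G \isog H -> ('Phi(G) == 1) = ('Phi(H) == 1).
Proof. by move/isog_Phi; apply: isog_eq1. Qed.

Section Morphim.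

Variables (gT rT : finGroupType) (D G : {group gT}) (f : {morphism D >-> rT}).
Hypothesis sGD : G \subset D.

Lemma Phi_quotient_morphpre (K : {group rT}) : K <| f @* G ->
  ('Phi(G / (G :&: f @*^-1 K)) == 1) = ('Phi(f @* G / K) == 1).
Proof.
move=> nsK; have nKG := normal_norm nsK.
have dG : G \subset f @*^-1 'N(K) by rewrite -sub_morphim_pre.
have := first_isog_loc [morphism of coset K \o f] dG.
by rewrite /= ker_comp ker_coset morphim_comp => /isog_Phi_eq1.
Qed.

(** Images and quotients can thus be tested inside the source group, where maximal subgroups are
    compared directly. *)
Lemma classB_morphim :
  classB (f @* G) <-> Phi_free_over G ('ker_G f).
Proof.
split=> [BfG M nsMG sKM | freeG K nsK].
  have nsfM : f @* M <| f @* G by rewrite morphim_normal.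
  have /eqP := BfG _ nsfM; rewrite -Phi_quotient_morphpre //= => /eqP.
  suff -> : G :&: f @*^-1 (f @* M) = M by [].
  have sMG := normal_sub nsMG.
  by rewrite morphimK ?(subset_trans sMG) // -group_modr // mulSGid.
apply/eqP; rewrite -Phi_quotient_morphpre //; apply/eqP.
apply: (freeG (G :&: f @*^-1 K)%G); last by rewrite setIS ?ker_sub_pre.
have sfGD := morphimS f sGD; have sKG := normal_sub nsK.
have nsfK : f @*^-1 K <| f @*^-1 (f @* G).
  by rewrite morphpre_normal ?(subset_trans sKG).
by apply: normalGI nsfK; rewrite -sub_morphim_pre.
Qed.
End Morphim.

Lemma classB_quotient gT (G N : {group gT}) : N <| G ->
  classB (G / N) <-> Phi_free_over G N.
Proof.
case/andP=> sNG nNG; have := classB_morphim (coset N) nNG.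
by rewrite ker_coset (setIidPr sNG).
Qed.

Lemma classB_Phi_free gT (G : {group gT}) : classB G <-> Phi_free_over G 1.
Proof. by split=> freeG N nsNG; [move=> _ | have := freeG N nsNG (sub1G N)]; auto. Qed.

Lemma classB_epi : epi_closed classB.
Proof.
move=> gT rT G f BG; apply/classB_morphim=> // M nsMG _; exact: BG.
Qed.

Lemma epi_isom_closed X : epi_closed X -> isom_closed X.
Proof.
move=> epiX gT rT G H /isogP[f _ defH] XG.
by rewrite -(group_inj defH); apply: epiX.
Qed.

Lemma classB_isog gT rT (G : {group gT}) (H : {group rT}) :
  G \isog H -> classB G -> classB H.
Proof. exact: (epi_isom_closed classB_epi). Qed.

Lemma classB_formation : formation classB.
Proof.
split; [exact: epi_isom_closed classB_epi | exact: classB_epi |].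
move=> gT G M N nsMG nsNG /(classB_quotient nsMG) BM /(classB_quotient nsNG) BN.
apply/(classB_quotient (normalI nsMG nsNG)); exact: Phi_free_overI.
Qed.

(** If [R / K] were not Frattini, [Phi_free_over_chief] would put [G / K] in [classB], against the
    minimality of the residual [R]. *)
Lemma classB_tn_formation : tn_formation classB.
Proof.
split=> [|gT G R K [nsRG BR minR] chR]; first exact: classB_formation.
have [/maxgroupP[/andP[ltKR nKG] _] _] := andP chR.
have sKR := proper_sub ltKR; have sRG := normal_sub nsRG.
have nsKG : K <| G by rewrite /normal (subset_trans sKR sRG).
apply: contraLR ltKR => /(not_Phi_quotient nsKG sKR sRG)[H [maxH sKH nRH]].
rewrite properE negb_and orbC negbK minR //.
apply/(classB_quotient nsKG); apply: Phi_free_over_chief chR maxH sKH nRH _.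
exact/(classB_quotient nsRG).
Qed.

(** * The equalities between F, E_Phi B and NB *)

Section NilpotentByB.

Variable gT : finGroupType.
Implicit Types A B G H K L M N R U X : {group gT}.

Lemma Phi_free_over_self G : Phi_free_over G G.
Proof.
move=> M /andP[sMG _] sGM; have -> : M = G by apply/group_inj/eqP; rewrite eqEsubset sMG.
by apply/trivgP; rewrite -(trivg_quotient G) Phi_sub.
Qed.

Lemma minnormal_chief G A : minnormal A G -> A \subset G -> chief_factor G 1 A.
Proof.
case/mingroupP=> /andP[ntA nAG] minA sAG; rewrite /chief_factor /normal sAG nAG !andbT.
apply/maxgroupP; split=> [|H /andP[/andP[sHA nsAH] nHG] _].
  by rewrite properE sub1G subG1 ntA norm1 subsetT.
by apply: contraNeq nsAH => ntH; rewrite (minA H) // ntH.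
Qed.

Lemma not_sub_Phi G A : A \subset G -> ~~ (A \subset 'Phi(G)) ->
  exists2 H : {group gT}, maximal H G & ~~ (A \subset H).
Proof.
move=> sAG nAPhi; suff /exists_inP[H maxH nAH]:
  [exists (H : {group gT} | maximal H G), ~~ (A \subset H)] by exists H.
apply: contraR nAPhi; rewrite negb_exists_in => /forall_inP sA.
apply/bigcapsP=> H /predU1P[-> // | maxH].
by apply: negbNE; apply: sA.
Qed.

(** Normalizers grow in [N]: if [H] were the whole normalizer of [N :&: H] in [G], then [N :&: H]
    would be self-normalizing in [N], hence equal to [N]. *)
Lemma nilpotent_maximal_normal G N H : N <| G -> nilpotent N -> maximal H G ->
  N :&: H <| G.
Proof.
move=> nsNG nilN maxH; have [sNG nNG] := andP nsNG.
have [sHG _] := andP (maxgroupp maxH).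
rewrite /normal subIset ?sNG //=.
have sHnorm : H \subset 'N_G(N :&: H).
  by rewrite subsetI sHG normsI ?normG // (subset_trans sHG).
case: (boolP (N \subset H)) => [/setIidPl -> // | nNH].
case/maximal_eqP: (predU1r H G maxH) => _ /(_ 'N_G(N :&: H)%G sHnorm (subsetIl _ _)).
case=> [/= defH | /setIidPl //]; case/negP: nNH.
apply/setIidPl/esym/nilpotent_sub_norm; rewrite ?subsetIl //= subsetI subsetIl /=.
by apply: subset_trans (setSI _ sNG) _; rewrite defH.
Qed.

End NilpotentByB.

Lemma epi_quotient X gT (G N : {group gT}) : epi_closed X -> N <| G ->
  X gT G -> X (coset_of N) (G / N)%G.
Proof.
(* [epi_closed] speaks of morphisms with domain exactly [G], so the coset map is restricted. *)
move=> epiX nsNG XG; have := epiX _ _ _ (restrm_morphism (normal_norm nsNG) (coset N)) XG.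
congr (X _ _); apply: group_inj.
by rewrite /= /restrm /= morphim_restrm setIid.
Qed.

Lemma classB_third_isog gT (G M N : {group gT}) : M <| G -> N <| G -> M \subset N ->
  classB (G / N) <-> classB (G / M / (N / M)).
Proof.
move=> nsMG nsNG sMN; have isoG := third_isog sMN nsMG nsNG.
by split; apply: classB_isog; rewrite // isog_sym.
Qed.

Lemma nilpotent_by_epi : epi_closed (nilpotent_by classB).
Proof.
move=> gT rT G f [N [nsNG nilN BGN]]; exists (f @* N)%G.
rewrite morphim_normal ?morphim_nil //; split=> //.
have := @classB_epi _ _ _ (quotm_morphism f nsNG) BGN.
by congr (classB _); apply: group_inj; apply: morphim_quotm.
Qed.

(** Induction on [#|G|]. A minimal normal subgroup [A] of [G] below [N] is missed by some maximal
    [H], so by [Phi_free_over_chief] it suffices that [G / A] is in [classB]; by induction this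
    reduces to ['Phi(G / A) = 1]. *)
Lemma nilpotent_by_Phi1 gT (G : {group gT}) :
  nilpotent_by classB G -> 'Phi(G) = 1 -> classB G.
Proof.
have [n] := ubnP #|G|; elim: n gT G => // n IHn gT G leGn FG PhiG.
have [N [nsNG nilN /(classB_quotient nsNG) BN]] := FG.
have [sNG nNG] := andP nsNG; apply/classB_Phi_free.
have [N1 | ntN] := eqVneq N 1%G; first by rewrite N1 in BN.
have [A minA sAN] := minnormal_exists ntN nNG.
have [/andP[ntA nAG] minAG] := mingroupP minA.
have sAG := subset_trans sAN sNG; have nsAG : A <| G by apply/andP.
have [|H maxH nAH] := @not_sub_Phi _ G A sAG; first by rewrite PhiG subG1.
have tiA (K : {group gT}) : maximal K G -> ~~ (A \subset K) -> A :&: K = 1.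
  move=> maxK nAK; have nsAK := nilpotent_maximal_normal nsAG (nilpotentS sAN nilN) maxK.
  apply: contraNeq nAK => ntAK; apply/setIidPl; apply: minAG; rewrite ?subsetIl //.
  by rewrite ntAK normal_norm.
apply: (Phi_free_over_chief (minnormal_chief minA sAG) maxH (sub1G H) nAH).
apply/(classB_quotient nsAG)/IHn.
- exact: leq_trans (ltn_quotient ntA sAG) leGn.
- exact: epi_quotient nilpotent_by_epi nsAG FG.
apply/eqP/(Phi_quotient_trivP nsAG) => X nsXG sAX sX.
have sXN : X \subset N.
  apply: Phi_quotient1_sub nsNG (BN N nsNG (subxx _)) nsXG _ => L maxL sNL.
  by rewrite sX // (subset_trans sAN).
(* If [X :&: H] is nontrivial, a minimal normal [B] inside it is missed by a maximal [K];
   [maximal_over_avoiding] then yields a maximal subgroup above [A] missing [B], although it must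
   contain [X]. *)
have defX : A * (X :&: H) = X.
  by rewrite setIC group_modl // (maximal_mulg maxH) // (setIidPr (normal_sub nsXG)).
have nsXH : X :&: H <| G.
  exact: nilpotent_maximal_normal nsXG (nilpotentS sXN nilN) maxH.
have [XH1 | ntXH] := eqVneq (X :&: H) 1.
  by rewrite -defX XH1 mulg1.
have [B minB sBXH] := minnormal_exists ntXH (normal_norm nsXH).
have [sBX sBH] := subsetIP sBXH.
have [/andP[ntB nBG] _] := mingroupP minB.
have nsBG : B <| G by rewrite /normal (subset_trans sBX (normal_sub nsXG)).
have [|K maxK nBK] := @not_sub_Phi _ G B (normal_sub nsBG); first by rewrite PhiG subG1.
have nAK : ~~ (A \subset K) by apply: contra nBK => sAK; rewrite (subset_trans sBX) ?sX.
have [|M [maxM sAM /negP[]]] := maximal_over_avoiding maxH maxK nsAG nsBG nAH nBK sBH.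
  by rewrite tiA ?sub1G.
by rewrite (subset_trans sBX) ?sX.
Qed.

Lemma EPhi_nilpotent_by : eqclass (EPhi classB) (nilpotent_by classB).
Proof.
move=> gT G; split=> [[N [nsNG sNPhi BGN]] | FG].
  by exists N; rewrite (nilpotentS sNPhi (Phi_nil G)).
exists 'Phi(G)%G; rewrite Phi_normal; split=> //.
apply: nilpotent_by_Phi1 (Phi_quotient_id G).
exact: epi_quotient nilpotent_by_epi (Phi_normal G) FG.
Qed.

(** For [G] in [classF] the witness is ['Phi(G)]. Conversely, ['Phi(G) N] contains the witness [N0],
    so the quotient by it has trivial Frattini subgroup, which bounds the preimage of
    ['Phi(G / N)]. *)
Lemma classF_EPhi : eqclass classF (EPhi classB).
Proof.
move=> gT G; split=> [FG | [N0 [nsN0 sN0Phi /(classB_quotient nsN0) BN0]] N nsNG].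
  exists 'Phi(G)%G; rewrite Phi_normal; split=> //.
  apply/(classB_quotient (Phi_normal G)) => M nsMG sPhiM.
  by rewrite FG // mulSGid // trivg_quotient.
have nPhiN : 'Phi(G) \subset 'N(N) := subset_trans (Phi_sub G) (normal_norm nsNG).
apply/eqP; rewrite quotientMidr eqEsubset andbC.
(* This inclusion, of the image of ['Phi(G)] in ['Phi(G / N)], holds in every group. *)
rewrite [X in X && _]morphimF ?normal_norm //=.
have nsXG : coset N @*^-1 'Phi(G / N) <| G.
  by rewrite -{2}(quotientGK nsNG) cosetpre_normal Phi_normal.
have nsY : 'Phi(G) <*> N <| G by rewrite normalY ?Phi_normal.
have sN0Y : N0 \subset 'Phi(G) <*> N := subset_trans sN0Phi (joing_subl _ _).
suff sXY : coset N @*^-1 'Phi(G / N) \subset 'Phi(G) <*> N.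
  rewrite -{1}(cosetpreK 'Phi(G / N)) -(quotientMidr N 'Phi(G)) -norm_joinEl //.
  exact: quotientS.
apply: (Phi_quotient1_sub nsY (BN0 _ nsY sN0Y) nsXG) => L maxL sYL.
apply: (quotient_sub_Phi nsNG (sub_cosetpre _) (normal_sub nsXG) _ L maxL).
  by rewrite cosetpreK.
exact: subset_trans (joing_subr _ _) sYL.
Qed.

Lemma classF_nilpotent_by gT (G : {group gT}) : classF G <-> nilpotent_by classB G.
Proof. exact: iff_trans (classF_EPhi G) (EPhi_nilpotent_by G). Qed.

(** * F is the smallest saturated formation containing B *)

Lemma nilpotent_quotientP gT (U M : {group gT}) : U \subset 'N(M) ->
  reflect (exists n, 'L_n.+1(U) \subset M) (nilpotent (U / M)).
Proof.
move=> nMU; apply: (iffP (lcnP _)) => [] [n sLM]; exists n.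
  rewrite -quotient_sub1 ?(subset_trans (lcn_sub _ _)) //.
  by rewrite quotientE morphim_lcn // -quotientE sLM.
apply/trivgP; rewrite /= /quotient -morphim_lcn // -quotientE quotient_sub1 //.
exact: subset_trans (lcn_sub _ _) nMU.
Qed.

Lemma nilpotent_quotientI gT (U M N : {group gT}) :
    U \subset 'N(M) -> U \subset 'N(N) ->
  nilpotent (U / M) -> nilpotent (U / N) -> nilpotent (U / (M :&: N)).
Proof.
move=> nMU nNU /(nilpotent_quotientP nMU)[m sLM] /(nilpotent_quotientP nNU)[n sLN].
apply/nilpotent_quotientP; first exact: normsI.
exists (m + n)%N; rewrite subsetI.
rewrite (subset_trans _ sLM) ?(subset_trans _ sLN) //.
  by rewrite lcn_sub_leq // ltnS leq_addl.
by rewrite lcn_sub_leq // ltnS leq_addr.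
Qed.

Lemma nilpotent_by_quotientP gT (G M : {group gT}) : M <| G ->
  nilpotent_by classB (G / M) <->
  exists U : {group gT}, [/\ U <| G, M \subset U, nilpotent (U / M) & Phi_free_over G U].
Proof.
move=> nsMG; split=> [[Ub [nsUb nilUb BUb]] | [U [nsUG sMU nilU BU]]].
  case/(inv_quotientN nsMG): nsUb nilUb BUb => U -> sMU nsUG nilU.
  move/(classB_third_isog nsMG nsUG sMU)/(classB_quotient nsUG).
  by exists U.
exists (U / M)%G; rewrite quotient_normal //; split=> //.
exact/(classB_third_isog nsMG nsUG sMU)/(classB_quotient nsUG).
Qed.

Lemma classF_formation : formation classF.
Proof.
have epiF : epi_closed classF.
  move=> gT rT G f /classF_nilpotent_by FG.
  exact/classF_nilpotent_by/nilpotent_by_epi.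
split=> // [|gT G M N nsMG nsNG]; first exact: epi_isom_closed.
move=> /classF_nilpotent_by/(nilpotent_by_quotientP nsMG)[U [nsU sMU nilU BU]].
move=> /classF_nilpotent_by/(nilpotent_by_quotientP nsNG)[V [nsV sNV nilV BV]].
have nsUV := normalI nsU nsV; have sUVG := normal_sub nsUV.
apply/classF_nilpotent_by/(nilpotent_by_quotientP (normalI nsMG nsNG)).
exists (U :&: V)%G; split=> //; first exact: setISS.
  apply: nilpotent_quotientI; rewrite ?(subset_trans sUVG) ?normal_norm //.
    by apply: nilpotentS nilU; rewrite quotientS ?subsetIl.
  by apply: nilpotentS nilV; rewrite quotientS ?subsetIr.
exact: Phi_free_overI.
Qed.

(** Frattini extensions compose: when [N] lies in every maximal subgroup of [G], the preimage of a
    subgroup of ['Phi(G / N)] lies in ['Phi(G)]. *)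
Lemma classF_saturated : saturated_formation classF.
Proof.
split=> [|gT G N nsNG sNPhi]; first exact: classF_formation.
case/classF_EPhi=> Mb [nsMb sMb BMb]; apply/classF_EPhi.
case/(inv_quotientN nsNG): nsMb sMb BMb => M -> sNM nsMG sM.
move/(classB_third_isog nsNG nsMG sNM) => BM; exists M; split=> //.
have/(quotient_sub_Phi nsNG sNM (normal_sub nsMG)) {}sM := sM.
apply/bigcapsP=> L /predU1P[-> | maxL]; first exact: normal_sub.
exact: sM (subset_trans sNPhi (Phi_sub_max maxL)).
Qed.

Lemma subclass_B_F : subclass classB classF.
Proof.
move=> gT G BG; apply/classF_EPhi; exists 1%G; rewrite normal1 sub1G; split=> //.
exact: epi_quotient classB_epi (normal1 G) BG.
Qed.

Lemma classF_smallest X :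
  saturated_formation X -> subclass classB X -> subclass classF X.
Proof.
move=> [_ satX] sBX gT G /classF_EPhi[N [nsNG sNPhi /sBX XN]].
exact: satX XN.
Qed.

(** * Centralizers of chief factors and the local definition of F *)

Section ChiefCentralizers.

Variable gT : finGroupType.
Implicit Types A B G H K L M N R U X : {group gT}.

Lemma chief_centralizer_normal G K H : chief_factor G K H -> 'C_G(H / K | 'Q) <| G.
Proof.
case/andP=> /maxgroupp/andP[_ nKG] /andP[_ nHG].
have nG : G \subset 'N(H / K | 'Q) := actsQ nKG nHG.
by rewrite /normal subsetIl normsI ?normG // (subset_trans nG) ?astab_norm.
Qed.

(** In [G / K], the minimal normal subgroup [H / K] either meets [N / K] trivially, and then they
    commute, or lies in it; then it meets ['Z(N / K)] nontrivially and so is central. *)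
Lemma nilpotent_centralizes_chief G N K H : N <| G -> nilpotent N ->
  chief_factor G K H -> N \subset 'C_G(H / K | 'Q).
Proof.
move=> nsNG nilN chH; have minH := chief_factor_minnormal chH.
have /andP[/maxgroupp/andP[_ nKG] nsHG] := chH.
have [sNG _] := andP nsNG.
rewrite subsetI sNG sub_astabQ (subset_trans sNG) //=.
have nsNb : N / K <| G / K by rewrite quotient_normal.
have nilNb : nilpotent (N / K) by rewrite quotient_nil.
have [/andP[ntH nHG] minHb] := mingroupP minH.
have nHN := subset_trans (normal_sub nsNb) nHG.
have [HN1 | ntHN] := eqVneq (H / K :&: N / K) 1.
  apply/commG1P/trivgP; rewrite -HN1 setIC commg_subI // subsetI subxx //=.
  exact: subset_trans (quotientS K (normal_sub nsHG)) (normal_norm nsNb).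
have sHN : H / K \subset N / K.
  apply/setIidPl; apply: (minHb (H / K :&: N / K)%G); last exact: subsetIl.
  by rewrite ntHN normsI // normal_norm.
have nsHN : H / K <| N / K by apply/andP.
have ntZ := meet_center_nil nilNb nsHN ntH.
have : H / K :&: 'Z(N / K) = H / K.
  apply: (minHb (H / K :&: 'Z(N / K))%G); last exact: subsetIl.
  by rewrite ntZ normsI // gFnorm_trans // normal_norm.
by move/setIidPl; rewrite subsetI centsC => /andP[].
Qed.

(** Descent of [D] along a chief series: intersecting [U] with the centralizer of [D / K] pushes the
    next term of the lower central series into [K]. Once [D] is trivial, [U] is nilpotent. *)
Lemma nilpotent_of_chief_centralizers G (D U : {group gT}) n :
    (forall H K (p : nat), chief_factor G K H -> prime p -> p %| #|H / K| ->
       Phi_free_over G 'C_G(H / K | 'Q)) ->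
    D <| G -> U <| G -> Phi_free_over G U -> 'L_n.+1(U) \subset D ->
  exists V : {group gT}, [/\ V <| G, nilpotent V & Phi_free_over G V].
Proof.
move=> locG; have [m] := ubnP #|D|; elim: m D U n => // m IHm D U n leDm nsD nsU BU sLD.
have [D1 | ntD] := eqVneq D 1%G.
  exists U; split=> //; apply/lcnP; exists n; apply/trivgP; by rewrite D1 in sLD.
have [K maxK] : {K : {group gT} | maxnormal K D G}.
  by apply: ex_maxgroup; exists 1%G; rewrite proper1G ntD norms1.
have [ltKD nKG] := andP (maxgroupp maxK).
have chD : chief_factor G K D by apply/andP.
have nsC := chief_centralizer_normal chD.
have sKG : K \subset G := subset_trans (proper_sub ltKD) (normal_sub nsD).
have [p_pr p_dv] : prime (pdiv #|D / K|) /\ pdiv #|D / K| %| #|D / K|.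
  rewrite pdiv_dvd; split=> //; apply: pdiv_prime; rewrite cardG_gt1.
  by have /mingroupp/andP[] := chief_factor_minnormal chD.
have BC := locG D K _ chD p_pr p_dv.
apply: (IHm K (U :&: 'C_G(D / K | 'Q))%G n.+1).
- exact: leq_trans (proper_card ltKD) leDm.
- exact/andP.
- exact: normalI.
- exact: Phi_free_overI.
have sIC : U :&: 'C_G(D / K | 'Q) \subset 'C(D / K | 'Q).
  by rewrite setIA subsetIr.
have sLD' := subset_trans (lcnS n.+1 (subsetIl U 'C_G(D / K | 'Q))) sLD.
rewrite lcnSn; apply: subset_trans (commSg _ sLD') _; rewrite commGC -sub_astabQR //.
  by rewrite (subset_trans _ nKG) // subIset // normal_sub.
exact: subset_trans (normal_sub nsD) nKG.
Qed.

End ChiefCentralizers.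

Lemma classF_local : locally_defined classF (fun _ => classB).
Proof.
move=> gT G; split=> [/classF_nilpotent_by[N [nsNG nilN BN]] H K p chH _ _ | locG].
  have nsC := chief_centralizer_normal chH.
  apply/(classB_quotient nsC); apply: Phi_free_overS (_ : N \subset _) _.
    exact: nilpotent_centralizes_chief.
  exact/(classB_quotient nsNG).
have nsG := normal_refl G.
(* The descent starts with [D = U = G] and [n = 0], since ['L_1(G)] is [G]. *)
have [|||V [nsV nilV BV]] := @nilpotent_of_chief_centralizers _ G G G 0 _ nsG nsG.
- move=> H K p chH p_pr p_dv; apply/(classB_quotient (chief_centralizer_normal chH)).
  exact: locG p_dv.
- exact: Phi_free_over_self.
- exact: lcn_sub.
apply/classF_nilpotent_by; exists V; split=> //; exact/(classB_quotient nsV).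
Qed.

(** * Closure of B and F under subnormal subgroups *)

Section NormalSubgroups.

Variable gT : finGroupType.
Implicit Types A B G H K L M N R S U X Y Z : {group gT}.

(** If a maximal [L] missed ['Phi(H)], Dedekind's law would give [H = 'Phi(H) (L :&: H)], and
    nongenerators could be dropped to put [H] inside [L]. *)
Lemma Phi_normalS G H : H <| G -> 'Phi(H) \subset 'Phi(G).
Proof.
move=> nsHG; have nsPhi : 'Phi(H) <| G := gFnormal_trans _ nsHG.
have sHG := normal_sub nsHG.
apply/bigcapsP=> L /predU1P[-> | maxL]; first exact: normal_sub.
apply: contraT => nPhiL; have defG := maximal_mulg maxL nsPhi nPhiL.
have defH : 'Phi(H) <*> (L :&: H) = H.
  rewrite norm_joinEr; first by rewrite group_modl ?Phi_sub // defG (setIidPr sHG).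
  by rewrite subIset // (subset_trans sHG) ?orbT // normal_norm.
have := Phi_nongen defH; rewrite genGid => /setIidPr sHL.
by case/negP: nPhiL; apply: subset_trans (Phi_sub H) sHL.
Qed.

Lemma minnormalJ H S x : x \in 'N(H) -> minnormal S H -> minnormal (S :^ x) H.
Proof.
move=> nHx /mingroupP[/andP[ntS nSH] minS]; have nHV : H :^ x^-1 = H.
  by rewrite (normP (groupVr nHx)).
apply/mingroupP; split=> [|K /andP[ntK nKH] sKS].
  by rewrite trivg_card1 cardJg -trivg_card1 ntS normJ -sub_conjgV nHV.
apply: canRL (conjsgKV x) _; apply: (minS (K :^ x^-1)%G).
  by rewrite trivg_card1 cardJg -trivg_card1 ntK /= normJ -sub_conjg (normP nHx).
by rewrite sub_conjgV.
Qed.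

(** A Clifford-type argument: [Z] is maximal among the [H]-invariant subgroups of [A] meeting [Y]
    trivially, and if [Y Z] were proper in [A], a minimal normal subgroup of [H] could be added to
    [Z]. *)
Lemma minnormal_complement G H A Y :
    minnormal A G -> H <| G -> A \subset H -> Y <| H -> Y \subset A ->
  exists Z, [/\ Z <| H, Y * Z = A & Y :&: Z = 1].
Proof.
case/mingroupP=> /andP[ntA nAG] minA nsHG sAH nsYH sYA.
have [sHG nHG] := andP nsHG.
pose P (Z : {group gT}) := [&& H \subset 'N(Z), Z \subset A & Y :&: Z == 1].
have [Z /maxgroupP[/and3P[nZH sZA /eqP tiYZ] maxZ]] : {Z : {group gT} | maxgroup Z P}.
  by apply: ex_maxgroup; exists 1%G; rewrite /P norm1 subsetT sub1G setIg1 /=.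
have nsZH : Z <| H by rewrite /normal (subset_trans sZA).
exists Z; split=> //; have defYZ : Y <*> Z = Y * Z.
  by rewrite norm_joinEr // (subset_trans (normal_sub nsZH)) ?normal_norm.
apply/eqP; rewrite eqEsubset mul_subG //= -defYZ; apply: contraT => nAYZ.
have [S0 minS0 sS0A] := minnormal_exists ntA (subset_trans sHG nAG).
have [/andP[ntS0 _] _] := mingroupP minS0.
(* The [G]-conjugates of [S0] generate a nontrivial [G]-invariant subgroup of [A], hence [A], so
   they cannot all lie in [Y Z]. *)
have [g Gg nSYZ] : exists2 g, g \in G & ~~ (S0 :^ g \subset Y <*> Z).
  apply/exists_inP; apply: contraR nAYZ; rewrite negb_exists_in => /forall_inP sS.
  have <- : <<class_support S0 G>> = A.
    apply: (minA <<class_support S0 G>>%G); last first.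
      by rewrite gen_subG class_support_sub_norm.
    rewrite norms_gen ?class_support_norm // andbT -subG1.
    apply: contra ntS0; rewrite -subG1; apply: subset_trans.
    by rewrite sub_gen // sub_class_support.
  rewrite gen_subG class_supportEr; apply/bigcupsP=> g /sS.
  by rewrite negbK.
have minS := minnormalJ (subsetP nHG g Gg) minS0.
have [/andP[ntS nSH] minS'] := mingroupP minS.
have sSA : S0 :^ g \subset A by rewrite -(normsP nAG g Gg) conjSg.
have nYZH : H \subset 'N(Y <*> Z) by rewrite normsY // normal_norm.
have tiS : (Y <*> Z) :&: S0 :^ g = 1.
  apply: contraNeq nSYZ => ntI; apply/setIidPr.
  by apply: (minS' (Y <*> Z :&: S0 :^ g)%G); rewrite ?subsetIr // ntI normsI.
have nZS : S0 :^ g \subset 'N(Z) by rewrite (subset_trans sSA) // (subset_trans sAH).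
have defI : (Z <*> S0 :^ g) :&: (Y <*> Z) = Z.
  rewrite (norm_joinEr nZS) -group_modl ?joing_subr //.
  by rewrite [X in Z * X]setIC tiS mulg1.
have defZS : Z <*> S0 :^ g = Z :> {set gT}.
  apply: (maxZ (Z <*> S0 :^ g)%G); last exact: joing_subl.
  rewrite /P normsY //= join_subG sZA sSA /= -subG1 -tiYZ subsetI subsetIl /=.
  apply: subset_trans (_ : (Z <*> S0 :^ g) :&: (Y <*> Z) \subset Z); last by rewrite defI.
  by rewrite setIC setIS ?joing_subl.
case/negP: nSYZ; apply: subset_trans (joing_subr Y Z).
by rewrite (subset_trans (joing_subr Z (S0 :^ g))) // defZS.
Qed.

End NormalSubgroups.

Lemma classB_normal gT (G H : {group gT}) : H <| G -> classB G -> classB H.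
Proof.
have [n] := ubnP #|G|; elim: n gT G H => // n IHn gT G H leGn nsHG BG.
have [sHG nHG] := andP nsHG.
have [H1 | ntH] := eqVneq H 1%G.
  by apply/classB_Phi_free; rewrite H1; apply: Phi_free_over_self.
have [A minA sAH] := minnormal_exists ntH nHG.
have [/andP[ntA nAG] minAG] := mingroupP minA.
have sAG := subset_trans sAH sHG.
have nsAG : A <| G by apply/andP.
have nsAH : A <| H := normalS sAH sHG nsAG.
have BHA : classB (H / A).
  apply: IHn (leq_trans (ltn_quotient ntA sAG) leGn) (quotient_normal A nsHG) _.
  exact: epi_quotient classB_epi nsAG BG.
have PhiG : 'Phi(G) = 1.
  by apply/eqP; rewrite (isog_Phi_eq1 (quotient1_isog G)); apply/eqP/BG/normal1.
have PhiH : 'Phi(H) = 1 by apply/trivgP; rewrite -PhiG Phi_normalS.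
have [nilA | notnilA] := boolP (nilpotent A).
  by apply: nilpotent_by_Phi1 => //; exists A.
(* The intersection is normalized by [G]; if nontrivial it would be [A], making [A] nilpotent. *)
have FA1 : 'F(H) :&: A = 1.
  apply: contraNeq notnilA => ntFA; apply: nilpotentS (Fitting_nil H).
  apply/setIidPr; apply: (minAG ('F(H) :&: A)%G); last exact: subsetIr.
  by rewrite ntFA normsI // gFnorm_trans.
move=> N nsNH; apply/eqP/(Phi_quotient_trivP nsNH) => X nsXH sNX sX.
have nsAN : A <*> N <| H by rewrite normalY.
have nsIH := normalI nsAH nsNH.
have [Z [nsZH defA tiZ]] := minnormal_complement minA nsHG sAH nsIH (subsetIl A N).
have sZA : Z \subset A by rewrite -defA mulG_subr.
(* [H / A] in [classB] confines [X] to [A N], and [A = (A :&: N) Z] turns this into [N Z]. *)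
have sXNZ : X \subset N * Z.
  have sXAN : X \subset A <*> N.
    have freeA := (classB_quotient nsAH).1 BHA.
    apply: (Phi_quotient1_sub nsAN (freeA _ nsAN (joing_subl _ _)) nsXH) => L maxL sANL.
    by rewrite sX // (subset_trans (joing_subr A N)).
  apply: subset_trans sXAN _.
  rewrite norm_joinEr ?(subset_trans (normal_sub nsNH)) ?normal_norm //.
  rewrite normC ?(subset_trans (normal_sub nsAH)) ?normal_norm // -defA mulgA.
  by rewrite mulSg // mul_subG ?subsetIr.
have defX : N * (Z :&: X) = X.
  by rewrite group_modl // (setIidPr sXNZ).
suff ZX1 : Z :&: X = 1 by rewrite -defX ZX1 mulg1.
(* [Z :&: X] meets [N] trivially, so it embeds in the nilpotent group ['Phi(H / N)]; being normal in
   [H], it lies in ['F(H)]. *)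
apply/trivgP; rewrite -FA1 subsetI (subset_trans (subsetIl Z X) sZA) andbT.
apply: Fitting_max; first exact: normalI.
have sXH := normal_sub nsXH.
have nNZX : Z :&: X \subset 'N(N).
  by rewrite subIset // (subset_trans sXH) ?orbT ?normal_norm.
have tiN : N :&: (Z :&: X) = 1.
  have sIZ : N :&: (Z :&: X) \subset Z by rewrite setICA subsetIl.
  by apply/trivgP; rewrite -tiZ subsetI sIZ subsetI (subset_trans sIZ sZA) subsetIl.
rewrite (isog_nil (quotient_isog nNZX tiN)).
apply: nilpotentS (Phi_nil (H / N)); apply: subset_trans (quotientS N (subsetIr Z X)) _.
exact/(quotient_sub_Phi nsNH sNX sXH).
Qed.

(** The witness is [N :&: H]: by the second isomorphism theorem its quotient is a normal subgroup of
    [G / N], to which [classB_normal] applies. *)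
Lemma classF_normal gT (G H : {group gT}) : H <| G -> classF G -> classF H.
Proof.
move=> nsHG /classF_nilpotent_by[N [nsNG nilN BGN]]; apply/classF_nilpotent_by.
have sHG := normal_sub nsHG; exists (N :&: H)%G; split.
- by rewrite /= setIC; apply: normalGI nsNG.
- exact: nilpotentS (subsetIl _ _) nilN.
have nNH := subset_trans sHG (normal_norm nsNG).
apply: (@classB_isog _ _ (H / N)%G); first by rewrite isog_sym second_isog.
exact: classB_normal (quotient_normal N nsHG) BGN.
Qed.

Lemma normal_subnormally_closed (X : group_class) :
    (forall (gT : finGroupType) (G H : {group gT}), H <| G -> X gT G -> X gT H) ->
  subnormally_closed X.
Proof.
move=> normX gT G H; have [n] := ubnP #|G|; elim: n G => // n IHn G leGn.
case/subnormalEr=> [/group_inj -> // | [K [snHK nsKG ltKG]] XG].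
by apply: IHn snHK (normX _ _ _ nsKG XG); apply: leq_trans (proper_card ltKG) leGn.
Qed.

Theorem theoremB :
  (subnormally_closed classB /\ tn_formation classB) /\
  (eqclass classF (EPhi classB) /\ eqclass (EPhi classB) (nilpotent_by classB)) /\
  ((saturated_formation classF /\ subclass classB classF /\
    (forall X : group_class,
       saturated_formation X -> subclass classB X -> subclass classF X)) /\
   (formation_function (fun _ : nat => classB) /\
    locally_defined classF (fun _ : nat => classB)) /\
   subnormally_closed classF).
Proof.
split; first split.
- exact: normal_subnormally_closed classB_normal.
- exact: classB_tn_formation.
split; first by split; [exact: classF_EPhi | exact: EPhi_nilpotent_by].
split; last split.
- split; first exact: classF_saturated.
  by split; [exact: subclass_B_F | exact: classF_smallest].
- by split; [move=> p _; exact: classB_formation | exact: classF_local].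
exact: normal_subnormally_closed classF_normal.
Qed.
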